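(* Let $G$ be an $n$-vertex $d$-regular graph. Then $G$ contains a full subgraph with $\lfloor \frac{n}{2} \rfloor$ or $\lfloor \frac{n}{2} \rfloor + 1$ vertices.
   Context: Graphs are finite and simple. The density of a graph $G$ on $n \geq 2$ vertices is $p = |E(G)|/\binom{n}{2}$ (so $p = d/(n-1)$ if $G$ is $d$-regular). A full subgraph of a graph $G$ of density $p$ is an $m$-vertex subgraph $H$ of $G$ of minimum degree at least $p(m-1)$. *)

(* Defs.v *)
From mathcomp Require Import all_boot all_order all_algebra.

Set Implicit Arguments.
Unset Strict Implicit.
Unset Printing Implicit Defensive.

Import Order.TTheory GRing.Theory Num.Theory.

(* The vertices form a subset of an ambient finite type, so that a graph and
   its subgraphs have the same type. *)
Record sgraph (T : finType) := SGraph {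
  verts : {set T};
  edges : {set {set T}};
  edgesP : forall A : {set T}, A \in edges -> A \subset verts /\ #|A| = 2
}.

Section Graphs.

Variable T : finType.
Implicit Types G H : sgraph T.

Definition degree G (v : T) : nat := #|[set A in edges G | v \in A]|.

Definition regular G (d : nat) : Prop :=
  forall v, v \in verts G -> degree G v = d.

(* Degrees are smaller than #|verts G|, so the seed of the minimum only matters
   when there is no vertex, where it makes the value 0. *)
Definition min_degree G : nat :=
  \big[minn/#|verts G|]_(v in verts G) degree G v.

(* Subgraphs need not be induced. *)
Definition subgraph H G : Prop :=
  verts H \subset verts G /\ edges H \subset edges G.

Local Open Scope ring_scope.

(* Only meaningful for graphs with at least two vertices. *)
Definition density G : rat := #|edges G|%:R / 'C(#|verts G|, 2)%:R.

Definition full_subgraph H G : Prop :=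
  subgraph H G /\ density G * (#|verts H|%:R - 1) <= (min_degree H)%:R.

End Graphs.

(* Main.v *)
(** Among the sets [A] of [n./2] vertices choose one spanning the most edges, and
    let [B] be its complement.  Exchanging [a] in [A] with [b] in [B] does not
    increase the number of edges inside [A], so [b] has at most one more
    neighbour in [A] than [a] has, and at most as many unless [a] and [b] are
    adjacent.  With [h] the upper half of [d], suppose that [a] has fewer than
    [h] neighbours in [A] and that some [b] has fewer than [h] neighbours in [B].
    Then [d] is odd, [a] is adjacent to every such [b], and [a |: B] induces
    minimum degree at least [h]; as [d] is odd, [n] is even and this set has
    [n./2.+1] vertices. *)
Require Import Defs.
From mathcomp Require Import all_boot all_order all_algebra.
From mathcomp Require Import zify.

Set Implicit Arguments.
Unset Strict Implicit.
Unset Printing Implicit Defensive.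

Import Order.TTheory GRing.Theory Num.Theory.

Section Graphs.

Variable T : finType.
Implicit Types (G H : sgraph T) (S : {set T}).

Definition adjacent G (u v : T) : bool := [set u; v] \in edges G.

Definition neighbours G S (v : T) : {set T} := [set u in S | adjacent G v u].

Lemma adjacentC G u v : adjacent G u v = adjacent G v u.
Proof. by rewrite /adjacent setUC. Qed.

Lemma adjacentxx G v : adjacent G v v = false.
Proof. by apply/negP => /edgesP [_]; rewrite setUid cards1. Qed.

Lemma degreeE G v : degree G v = #|neighbours G (verts G) v|.
Proof.
rewrite /degree.
have inj : {in neighbours G (verts G) v &, injective (fun u => [set v; u])}.
  move=> x y; rewrite !inE => /andP[_ vx] _ /setP/(_ x).
  rewrite !inE eqxx orbT; case: (eqVneq x v) => [xv|_ /esym/eqP //].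
  by rewrite xv adjacentxx in vx.
rewrite -(card_in_imset inj); apply: eq_card => A; rewrite inE.
apply/andP/imsetP => [[AE vA]|[u]].
  have [AV /eqP/cards2P[x [y [xy defA]]]] := edgesP AE.
  have [xA yA] : x \in A /\ y \in A by rewrite defA !inE !eqxx orbT.
  move: vA; rewrite defA !inE => /orP[]/eqP vE.
    by exists y; rewrite vE // !inE (subsetP AV) // /adjacent -defA.
  exists x; rewrite vE 1?setUC // !inE (subsetP AV) //.
  by rewrite /adjacent setUC -defA.
by rewrite !inE => /andP[_ uv] ->; rewrite !inE eqxx.
Qed.

Lemma degree_lt G v : v \in verts G -> degree G v < #|verts G|.
Proof.
move=> vV; rewrite degreeE; apply/proper_card/properP; split.
  by apply/subsetP => u; rewrite inE => /andP[].
by exists v; rewrite // inE adjacentxx andbF.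
Qed.

Lemma sum_degree G : \sum_(v in verts G) degree G v = (#|edges G|).*2.
Proof.
rewrite /degree; under eq_bigr => v _ do
  (rewrite -sum1_card; under eq_bigl => A do rewrite inE).
rewrite (exchange_big_dep (mem (edges G))) /=; last by move=> v A _ /andP[].
rewrite -muln2 -sum_nat_const; apply: eq_bigr => A AE.
have [AV <-] := edgesP AE.
rewrite -sum1_card; apply: eq_bigl => v; rewrite AE /=.
by case: (boolP (v \in A)) => [/(subsetP AV) ->|]; rewrite ?andbF.
Qed.

(** The first hypothesis handles the seed [#|verts G|] of the minimum. *)
Lemma leq_min_degree G h :
  h <= #|verts G| -> (forall v, v \in verts G -> h <= degree G v) ->
  h <= min_degree G.
Proof.
move=> hV hdeg; rewrite /min_degree.
by elim/big_ind: _ => // x y hx hy; rewrite leq_min hx.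
Qed.

Fact induced_edgesP G S (A : {set T}) :
  A \in [set A in edges G | A \subset S] -> A \subset S /\ #|A| = 2.
Proof. by rewrite inE => /andP[/edgesP[_ ->] ->]. Qed.

Definition induced G S : sgraph T := SGraph (@induced_edgesP G S).

Lemma subgraph_induced G S : S \subset verts G -> subgraph (induced G S) G.
Proof. by move=> SV; split=> //; apply/subsetP => A; rewrite inE => /andP[]. Qed.

Lemma degree_induced G S v :
  v \in S -> degree (induced G S) v = #|neighbours G S v|.
Proof.
move=> vS; rewrite degreeE; apply: eq_card => u; rewrite !inE /adjacent inE /=.
case: (boolP (u \in S)) => //= uS.
by rewrite subUset !sub1set vS uS !andbT.
Qed.

Lemma card_neighboursU1 G S v u :
  u \notin S -> #|neighbours G (u |: S) v| = #|neighbours G S v| + adjacent G v u.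
Proof.
move=> uS; case: (boolP (adjacent G v u)) => vu.
  rewrite (_ : neighbours _ _ _ = u |: neighbours G S v).
    by rewrite cardsU1 inE (negbTE uS) addnC.
  by apply/setP => x; rewrite !inE; case: eqVneq => // ->; rewrite vu.
rewrite addn0; apply: eq_card => x; rewrite !inE.
by case: eqVneq => // ->; rewrite (negbTE vu) (negbTE uS).
Qed.

Lemma card_neighboursD G S v :
  S \subset verts G ->
  #|neighbours G S v| + #|neighbours G (verts G :\: S) v| = degree G v.
Proof.
move=> SV; rewrite degreeE -(cardsID S (neighbours G (verts G) v)).
congr (_ + _); apply: eq_card => u; rewrite !inE //.
  by case: (boolP (u \in S)) => [/(subsetP SV) ->|]; rewrite ?andbT ?andbF.
by rewrite andbA.
Qed.

(** Split the edges according to whether they contain [v]: those that do are counted by the degree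
    of [v], the others lie inside [S]. *)
Lemma card_edges_inducedU1 G S v :
  v \notin S ->
  #|edges (induced G (v |: S))| = #|edges (induced G S)| + #|neighbours G S v|.
Proof.
move=> vS; have -> : #|neighbours G S v| = degree (induced G (v |: S)) v.
  by rewrite degree_induced ?setU11 // card_neighboursU1 // adjacentxx addn0.
rewrite -(cardsID [set A : {set T} | v \in A]) addnC; congr (_ + _).
  apply: eq_card => A; rewrite !inE andbCA; congr (_ && _).
  apply/andP/idP => [[vA /subsetP AvS]|AS].
    apply/subsetP => x xA; move: (AvS _ xA); rewrite !inE => /orP[/eqP xv|//].
    by rewrite -xv xA in vA.
  split; first by apply: contra vS => /(subsetP AS).
  by apply: subset_trans AS _; apply: subsetUr.
by apply: eq_card => A; rewrite !inE.
Qed.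

Lemma exists_optimal_set G k :
  k <= #|verts G| ->
  exists S : {set T}, [/\ S \subset verts G, #|S| = k &
    forall a b, a \in S -> b \in verts G :\: S ->
      #|neighbours G S b| <= #|neighbours G S a| + adjacent G a b].
Proof.
move=> kV; pose P S := (S \subset verts G) && (#|S| == k).
have [S0 PS0] : exists S, P S.
  have /card_gt0P[S] : 0 < #|[set S : {set T} | P S]|.
    by rewrite cards_draws bin_gt0.
  by rewrite inE; exists S.
case: (@arg_maxnP _ S0 P (fun S => #|edges (induced G S)|) PS0).
move=> S /andP[SV /eqP cardS] maxS; exists S; split=> // a b aS.
rewrite inE => /andP[bS bV]; pose C := S :\ a.
have aC : a \notin C by rewrite !inE eqxx.
have bC : b \notin C by rewrite inE (negbTE bS) andbF.
have defS : S = a |: C by rewrite setD1K.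
have /maxS : P (b |: C).
  rewrite /P subUset sub1set bV (subset_trans (subsetDl _ _) SV) /=.
  by rewrite cardsU1 bC -cardS [in #|S|]defS cardsU1 aC.
(* Cancelling the edges inside [C] from both counts, maximality says that [b] has at most as many
   neighbours in [C] as [a]. Putting [a] back can only add one neighbour to [b], namely [a], and
   adds none to [a] itself. *)
rewrite {1}defS /= !card_edges_inducedU1 // leq_add2l => Cba.
by rewrite defS !card_neighboursU1 // adjacentxx addn0 adjacentC leq_add2r.
Qed.

Lemma regular_card_edges G d :
  regular G d -> (#|edges G|).*2 = #|verts G| * d.
Proof. by move=> regG; rewrite -sum_degree -sum_nat_const; apply: eq_bigr. Qed.

Local Open Scope ring_scope.

(** A regular graph has density [d / (#|verts G| - 1)]; the last hypothesis is the required degree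
    bound with this denominator cleared. *)
Lemma full_induced G d S h :
  regular G d -> (1 < #|verts G|)%N -> S \subset verts G -> (0 < #|S|)%N ->
  (h <= #|S|)%N -> (forall v, v \in S -> h <= #|neighbours G S v|)%N ->
  (d * #|S|.-1 <= h * #|verts G|.-1)%N -> full_subgraph (induced G S) G.
Proof.
move=> regG V_gt1 SV S_gt0 hS degS dh; split; first exact: subgraph_induced.
have hmin : (h <= min_degree (induced G S))%N.
  by apply: leq_min_degree => //= v vS; rewrite degree_induced ?degS.
apply: (@le_trans _ _ h%:R); last by rewrite ler_nat.
rewrite /density mulrAC ler_pdivrMr ?ltr0n ?bin_gt0 //.
rewrite -[1]/(1%:R) -natrB // -!natrM ler_nat subn1 -leq_double -!muln2.
(* Twice the binomial and twice the number of edges are both multiples of [#|verts G|], which then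
   cancels. *)
have := mul_bin_diag #|verts G| 1; rewrite bin1 [(2 * _)%N]mulnC => binE.
rewrite mulnAC muln2 (regular_card_edges regG) -(mulnA h) -binE.
by rewrite -mulnA [leqRHS]mulnCA leq_mul2l dh orbT.
Qed.

End Graphs.

Theorem corollary6 (T : finType) (G : sgraph T) (n d : nat) :
  (2 <= n)%N -> #|verts G| = n -> regular G d ->
  exists H : sgraph T,
    full_subgraph H G /\ (#|verts H| = n./2 \/ #|verts H| = n./2.+1).
Proof.
move=> n_gt1 cardV regG; pose h := uphalf d.
have d_lt_n : d < n.
  have /card_gt0P[v vV] : 0 < #|verts G| by lia.
  by rewrite -(regG _ vV) -cardV degree_lt.
have odd_d_even_n : odd d -> ~~ odd n.
  move=> dodd; have /(congr1 odd) := regular_card_edges regG.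
  by rewrite odd_double cardV oddM dodd andbT => <-.
have [|A [AV cardA swapA]] := @exists_optimal_set _ G n./2; first by lia.
pose B := verts G :\: A.
have BV : B \subset verts G by apply: subsetDl.
have cardB : #|B| = n - n./2 by rewrite cardsDS // cardV cardA.
(* For the larger size the parity condition rules out [n] and [d] both even, where minimum degree
   [d / 2] can fall short of the density bound. *)
have full (S : {set T}) : S \subset verts G ->
    #|S| = n./2 \/ #|S| = n./2.+1 /\ odd n (+) odd d ->
    (forall v, v \in S -> h <= #|neighbours G S v|) ->
    exists H : sgraph T,
      full_subgraph H G /\ (#|verts H| = n./2 \/ #|verts H| = n./2.+1).
  move=> SV cardS degS; exists (induced G S).
  split; last by case: cardS => [|[]]; [left | right].
  apply: (full_induced (h := h) regG) => //; rewrite ?cardV; try by lia.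
  case: (boolP (odd d)) => [dodd|deven].
    (* Here [2 * h = d + 1], and [(d + 1) * (n - 1) - d * n = n - 1 - d] is nonnegative because
       [d < n]. *)
    have neven := odd_d_even_n dodd.
    have : d * #|S|.-1 <= d * n./2 by rewrite leq_mul2l; apply/orP; right; lia.
    have -> : h = d./2.+1 by lia.
    by have := odd_double_half d; have := odd_double_half n; nia.
  have dE : d = h * 2 by lia.
  by rewrite [leqLHS](_ : _ = h * (2 * #|S|.-1)) ?leq_mul2l; lia.
have [/forallP degA|] := boolP [forall v, (v \in A) ==> (h <= #|neighbours G A v|)].
  by apply: (full A) => // [|v]; [left | apply/implyP].
rewrite negb_forall => /existsP[a]; rewrite negb_imply -ltnNge => /andP[aA dega].
have aB : a \notin B by rewrite inE aA.
have aV : a \in verts G by apply: (subsetP AV).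
(* Such a [b] has at least [d - h + 1] neighbours in [A], while the exchange inequality allows at
   most [h - 1], plus one if [a] and [b] are adjacent. Since [2 * h <= d + 1], equality must hold
   throughout. *)
have low b : b \in B -> #|neighbours G B b| < h ->
    [/\ odd d, adjacent G a b & #|neighbours G B b| = h.-1].
  move=> bB degb; have := swapA a b aA bB.
  have := card_neighboursD b AV; rewrite regG ?(subsetP BV) // -/B.
  by case: (adjacent G a b) => /= ? ?; split=> //; lia.
have [/forallP degB|] := boolP [forall v, (v \in B) ==> (h <= #|neighbours G B v|)].
  (* [B] has [n./2.+1] vertices only when [n] is odd, and then [d] is even. *)
  by apply: (full B) => // [|v]; [lia | apply/implyP].
rewrite negb_forall => /existsP[b]; rewrite negb_imply -ltnNge => /andP[bB degb].
have [dodd _ _] := low b bB degb; have neven := odd_d_even_n dodd.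
apply: (full (a |: B)).
- by rewrite subUset sub1set aV.
- by right; rewrite cardsU1 aB cardB; lia.
(* The vertex [a] has at least [d - h + 1 = h] neighbours in [B]; a vertex of [B] that was short had
   exactly [h - 1] there and gains [a]. *)
move=> v; rewrite card_neighboursU1 // !inE => /orP[/eqP ->|vB].
  by have := card_neighboursD a AV; rewrite regG // -/B; lia.
rewrite adjacentC; have [|degv] := leqP h #|neighbours G B v|; first by lia.
by have [|_ -> ->] := low v _ degv; [rewrite inE | lia].
Qed.
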